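(* Let $G,H,K$ be Hilbert spaces and let $w\colon G\to H$ and $v\colon H\to K$ be partial isometries. Then there is a unique maximal projection $p_{v,w}$ on $G$ such that $(vwp_{v,w})^*(vwp_{v,w})=p_{v,w}$. Moreover, $p_{v,w}\le w^*w$, also $wp_{v,w}$ is a partial isometry, and $(wp_{v,w})(wp_{v,w})^*\le v^*v$.
   Context: Hilbert spaces are complex and operators are bounded and linear. A projection is an operator $p$ on a Hilbert space with $p^*p=p$ (that is, an orthogonal projection). An operator $v$ between Hilbert spaces is a partial isometry if $vv^*v=v$. Projections are ordered by the usual order $\le$ on self-adjoint operators ($a\le b$ iff $b-a$ is positive), and maximality refers to this order. *)

(* Defs.v *)
From HB Require Import structures.
From mathcomp Require Import all_boot all_order all_algebra.
From mathcomp Require Import sesquilinear complex.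
From mathcomp Require Import boolp classical_sets functions reals.
From mathcomp Require Import topology normedtype.

Set Implicit Arguments.
Unset Strict Implicit.
Unset Printing Implicit Defensive.

Import Order.TTheory GRing.Theory Num.Theory.
Import numFieldNormedType.Exports.

Local Open Scope complex_scope.
Local Open Scope ring_scope.

(* The inner product is linear in its first argument and conjugate-linear in
   its second one, as in sesquilinear. *)
HB.mixin Record CompleteNormedModule_isHilbert (R : realType) V
    & CompleteNormedModule R[i] V := {
  hdot : {dot V for (@Num.conj R[i])} ;
  norm_hdot : forall x : V, `|x| ^+ 2 = hdot x x
}.

#[short(type="hilbertType")]
HB.structure Definition Hilbert (R : realType) :=
  {V of CompleteNormedModule_isHilbert R V & CompleteNormedModule R[i] V}.

Record bop (R : realType) (G H : hilbertType R) := Bop {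
  bop_fun :> {linear G -> H};
  bop_bounded : exists M : R[i], forall x, `|bop_fun x| <= M * `|x|
}.

Section Operators.
Variable R : realType.
Implicit Types G H K : hilbertType R.

Lemma bopP G H (s t : bop G H) : s =1 t -> s = t.
Proof.
case: s t => [[f [[fa] [fs]]] fb] [[g [[ga] [gs]]] gb] /= fg.
have e : f = g by apply/funext.
subst g; rewrite (Prop_irrelevance fa ga).
by rewrite (Prop_irrelevance fs gs) (Prop_irrelevance fb gb).
Qed.

HB.instance Definition _ G H := gen_eqMixin (bop G H).
HB.instance Definition _ G H := gen_choiceMixin (bop G H).

Fact bop0_bounded G H :
  exists M : R[i], forall x : G, `|(\0 : {linear G -> H}) x| <= M * `|x|.
Proof. by exists 0 => x; rewrite /= normr0 mul0r. Qed.

Definition bop0 G H : bop G H := Bop (bop0_bounded G H).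

Fact bop_sub_bounded G H (s t : bop G H) :
  exists M : R[i], forall x, `|(s \- t) x| <= M * `|x|.
Proof.
have [[M sM] [N tN]] := (bop_bounded s, bop_bounded t).
exists (M + N) => x /=; rewrite mulrDl.
by rewrite (le_trans (ler_normB _ _))// lerD.
Qed.

Definition bop_sub G H (s t : bop G H) : bop G H := Bop (bop_sub_bounded s t).

Fact bop_comp_bounded G H K (s : bop H K) (t : bop G H) :
  exists M : R[i], forall x, `|(s \o t) x| <= M * `|x|.
Proof.
have [[M sM] [N tN]] := (bop_bounded s, bop_bounded t).
exists (`|M| * N) => x /=; rewrite -mulrA.
have [M0|] := boolP (0 <= M).
  by rewrite (le_trans (sM _))// ger0_norm// ler_wpM2l.
have [tx0 _|tx0 /negP[]] := eqVneq (t x) 0.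
  rewrite tx0 linear0 normr0 mulr_ge0//.
  by rewrite (le_trans _ (tN x)).
rewrite -(@pmulr_lge0 _ `|t x|) ?normr_gt0//.
by rewrite (le_trans _ (sM (t x))).
Qed.

Definition bop_comp G H K (s : bop H K) (t : bop G H) : bop G K :=
  Bop (bop_comp_bounded s t).

(* By the Riesz representation theorem such an operator exists and is unique,
   so that the default value bop0 is never used. *)
Definition adjoint G H (t : bop G H) : bop H G :=
  xget (bop0 H G) [set s | forall x y, hdot (t x) y = hdot x (s y)]%classic.

(* In the order of R[i], 0 <= z means that z is real and nonnegative. *)
Definition positive_op H (t : bop H H) := forall x, 0 <= hdot (t x) x.

Definition op_le H (s t : bop H H) := positive_op (bop_sub t s).

Definition projection H (p : bop H H) := bop_comp (adjoint p) p = p.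

Definition partial_isometry G H (v : bop G H) :=
  bop_comp v (bop_comp (adjoint v) v) = v.

Definition maximal_op H (S : bop H H -> Prop) (p : bop H H) :=
  S p /\ forall q, S q -> op_le p q -> q = p.

End Operators.

Declare Scope bop_scope.
Delimit Scope bop_scope with bop.
Bind Scope bop_scope with bop.
Notation "s * t" := (bop_comp s t) : bop_scope.
Notation "t ^*" := (adjoint t) : bop_scope.
Notation "s <= t" := (op_le s t) : bop_scope.

(* Main.v *)
(* A projection q satisfies (vwq)^*(vwq) = q iff vw is isometric on the range of
   q. As w and v are contractions, |vwx| = |x| forces |wx| = |x| and
   |vwx| = |wx|, i.e. w^*wx = x and v^*vwx = wx. These equations define a closed
   subspace of G, and the projection onto it is the greatest element of the set
   in question, not merely a maximal one. *)
Require Import Defs.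
From HB Require Import structures.
From mathcomp Require Import all_boot all_order all_algebra.
From mathcomp Require Import sesquilinear complex ring.
From mathcomp Require Import boolp classical_sets reals.
From mathcomp Require Import topology normedtype.

Set Implicit Arguments.
Unset Strict Implicit.
Unset Printing Implicit Defensive.

Import Order.TTheory GRing.Theory Num.Theory.
Import numFieldNormedType.Exports.

Local Open Scope classical_set_scope.
Local Open Scope complex_scope.
Local Open Scope ring_scope.

(** * Cauchy-Schwarz and nearest points in closed subspaces *)

Section InnerProduct.
Variables (R : realType) (V : hilbertType R).
Implicit Types x y z u : V.

Lemma hdotC x y : hdot x y = (hdot y x)^*.
Proof. by rewrite hermC expr0 mul1r. Qed.

Lemma hdot_eq0 x : hdot x x = 0 -> x = 0.
Proof. by move/eqP; rewrite dnorm_eq0 => /eqP. Qed.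

Lemma hdot_injr x y : (forall z, hdot z x = hdot z y) -> x = y.
Proof.
move=> xy; apply/eqP; rewrite -subr_eq0; apply/eqP/hdot_eq0.
by rewrite linearBr /= xy subrr.
Qed.

(** Pythagoras for the component of [u] orthogonal to [z], multiplied through by [hdot z z] so that
    it survives [z = 0]. Nonnegativity of the left side is Cauchy-Schwarz. *)
Lemma hdot_orthogonal_part u z (u' := u - (hdot u z / hdot z z) *: z) :
  hdot u' u' * hdot z z = hdot u u * hdot z z - `|hdot u z| ^+ 2.
Proof.
have [z0|z0] := eqVneq z 0.
  by rewrite z0 !linear0r normr0 expr0n !mulr0 subr0.
have zz0 : hdot z z != 0 by rewrite dnorm_eq0.
have u'z : hdot u' z = 0.
  by rewrite linearBl/= linearZl_LR/= divfK// subrr.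
have -> : hdot u' u' = hdot u' u.
  by rewrite {2}/u' linearBr/= linearZr_LR/= u'z mulr0 subr0.
rewrite /u' linearBl/= linearZl_LR/= mulrBl mulrAC divfK//.
by rewrite (hdotC z u) normCK.
Qed.

Lemma hdot_CauchySchwarz x y : `|hdot x y| <= `|x| * `|y|.
Proof.
rewrite -(@ler_pXn2r _ 2)// ?nnegrE ?mulr_ge0// exprMn !norm_hdot -subr_ge0.
by rewrite -hdot_orthogonal_part mulr_ge0// dnorm_ge0.
Qed.

(** Take [y] whose squared distance to [x] is within [e ^+ 2] of the infimum over [C]. Moving from
    [y] along [z] inside [C] can then gain at most [e ^+ 2], and by Pythagoras the best gain is the
    squared modulus of [hdot (x - y) z] over [hdot z z]. *)
Lemma exists_almost_orthogonal (C : set V) x (e : R[i]) :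
  C 0 -> (forall a y z, C y -> C z -> C (y + a *: z)) -> 0 < e ->
  exists2 y, C y & forall z, C z -> `|hdot (x - y) z| <= e * `|z|.
Proof.
move=> C0 CD e0.
(* Infima live in [R], so the squared distance is passed there through its real part. *)
pose q y := complex.Re (hdot (x - y) (x - y)).
have qE y : hdot (x - y) (x - y) = (q y)%:C.
  by rewrite /q RRe_real// ger0_real// dnorm_ge0.
have q0 y : 0 <= q y by rewrite -ler0c -qE dnorm_ge0.
have hl : has_lbound (q @` C) by exists 0 => _ [y _ <-].
have hi : has_inf (q @` C) by split=> //; exists (q 0); exists 0.
have eE : e = (complex.Re e)%:C by rewrite RRe_real// gtr0_real.
have Re0 : 0 < complex.Re e ^+ 2 by rewrite exprn_gt0// -ltcR -eE.
have [_ [y Cy <-] qy] := inf_adherent Re0 hi.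
(* [y + a *: z] is the point nearest to [x] on the line through [y] in direction [z]. *)
exists y => // z Cz; pose a := hdot (x - y) z / hdot z z.
have le_qa : inf (q @` C) <= q (y + a *: z).
  by apply: ge_inf => //; exists (y + a *: z) => //; exact: CD.
rewrite -(@ler_pXn2r _ 2)// ?nnegrE ?mulr_ge0 ?(ltW e0)// exprMn norm_hdot.
have := hdot_orthogonal_part (x - y) z; rewrite -/a -addrA -opprD => h.
have -> : `|hdot (x - y) z| ^+ 2 = ((q y)%:C - (q (y + a *: z))%:C) * hdot z z.
  by rewrite mulrBl -!qE h subKr.
rewrite ler_wpM2r ?dnorm_ge0// eE -rmorphB -rmorphXn/= lecR lerBlDl.
by rewrite (le_trans (ltW qy))// lerD2r.
Qed.

(* Approximate projections form a Cauchy filter because [x - y] and [x - y']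
   being almost orthogonal to [C] makes [y - y'] almost orthogonal to itself. *)
Lemma exists_orthogonal_projection (C : set V) x :
  closed C -> C 0 -> (forall a y z, C y -> C z -> C (y + a *: z)) ->
  exists2 y, C y & forall z, C z -> hdot (x - y) z = 0.
Proof.
move=> clC C0 CD.
pose A (e : R[i]) :=
  [set y | C y /\ forall z, C z -> `|hdot (x - y) z| <= e * `|z|].
pose F := filter_from [set e : R[i] | 0 < e] A.
have AS (e e' : R[i]) : e <= e' -> A e `<=` A e'.
  move=> ee y [Cy h]; split=> // z Cz.
  by rewrite (le_trans (h _ Cz))// ler_wpM2r.
have FF : ProperFilter F.
  apply: filter_from_proper; last first.
    move=> e e0; have [y Cy h] := exists_almost_orthogonal x C0 CD e0.
    by exists y; split.
  apply: filter_from_filter; first by exists 1 => /=.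
  move=> e e' /= e0 e'0.
  have [ee|ee] := real_leP (gtr0_real e0) (gtr0_real e'0).
    by exists e => // y h; split=> //; exact: AS h.
  by exists e' => // y h; split=> //; apply: AS h; exact: ltW.
have cF : cauchy F.
  apply: cauchy_exP => e e0.
  (* Two thirds bound the distance between approximate projections; the third makes the inequality
     strict. *)
  have e3 : 0 < e / 3 by rewrite divr_gt0.
  have [y [Cy hy]] := filter_ex (in_filter_from A e3 : F _).
  exists y; exists (e / 3) => // y' [Cy' hy']; rewrite -ball_normE /=.
  have [->|yy0] := eqVneq (y - y') 0; first by rewrite normr0.
  have Cz : C (y - y') by rewrite -(scaleN1r y'); exact: CD.
  rewrite (@le_lt_trans _ _ (e / 3 + e / 3))//; last first.
    by rewrite [ltRHS](_ : e = e / 3 + e / 3 + e / 3) ?ltrDl//; field.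
  rewrite -(@ler_pM2r _ `|y - y'|) ?normr_gt0// -expr2 norm_hdot mulrDl.
  have yyE : x - y' - (x - y) = y - y' by rewrite opprB [LHS]addrC addrA subrK.
  have -> : hdot (y - y') (y - y') =
      `|hdot (x - y') (y - y') - hdot (x - y) (y - y')|.
    by rewrite -linearBl/= yyE ger0_norm// dnorm_ge0.
  by rewrite (le_trans (ler_normB _ _))// lerD//; [exact: hy'|exact: hy].
have /cvg_ex[y Fy] : cvg F by exact: cauchy_cvg.
have FC : F C by exists 1; [exact: ltr01|move=> z []].
exists y; first exact: (closed_cvg (u_ := id) C clC FC y Fy).
move=> z Cz; apply/eqP; rewrite -normr_le0; apply/ler_addgt0Pr => e e0.
rewrite add0r.
have z1 : 0 < 1 + `|z| by rewrite ltr_pwDl.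
(* Two errors [d] times the norm of [z] must fit into [e]; the 1 in the denominator covers
   [z = 0]. *)
pose d := e / (1 + `|z|) / 2.
have d0 : 0 < d by rewrite !divr_gt0.
have [y' [[Cy' hy'] yy']] : (A d `&` ball y d) !=set0.
  apply: (filter_ex (F := F)); apply: filterI; first by exists d.
  exact/Fy/nbhsx_ballx.
have -> : hdot (x - y) z = hdot (x - y') z + hdot (y' - y) z.
  by rewrite -linearDl/= addrA subrK.
rewrite (le_trans (ler_normD _ _))//.
have -> : e = d * `|z| + d * `|z| + (d + d)
  by rewrite /d; field; rewrite gt_eqF.
rewrite (@le_trans _ _ (d * `|z| + d * `|z|))//; last first.
  by rewrite lerDl addr_ge0// ltW.
rewrite lerD ?hy'// (le_trans (hdot_CauchySchwarz _ _))// ler_wpM2r//.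
by rewrite distrC ltW//; move: yy'; rewrite -ball_normE.
Qed.

End InnerProduct.

(** * The Riesz representation theorem *)

Lemma closed_kernel (R : realType) (V W : normedModType R[i])
    (f : {linear V -> W}) (M : R[i]) :
  0 <= M -> (forall x, `|f x| <= M * `|x|) -> closed [set x | f x = 0].
Proof.
move=> M0 fM; have cf : continuous f.
  apply: bounded_linear_continuous; apply/linear_boundedP; near=> r => x.
  rewrite (le_trans (fM x))// ler_wpM2r//; near: r.
  by apply: nbhs_pinfty_ge; exact: ger0_real.
have /continuous_closedP/(_ [set 0]) := cf; apply.
exact: accessible_closed_set1 (hausdorff_accessible (@norm_hausdorff _ W)) _.
Unshelve. all: by end_near. Qed.

(** Let [u] be orthogonal to the kernel with [f u != 0]. Each [x - (f x / f u) *: u] is in the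
    kernel, hence orthogonal to [u], which determines [f x] from [hdot x u]. *)
Lemma Riesz_representation (R : realType) (V : hilbertType R)
    (f : {linear V -> R[i]^o}) (M : R[i]) :
  0 <= M -> (forall x, `|f x| <= M * `|x|) ->
  exists z, forall x, f x = hdot x z.
Proof.
move=> M0 fM.
have [[x0 fx0]|f0] := pselect (exists x, f x != 0); last first.
  exists 0 => x; rewrite linear0r; apply: contra_notP f0 => /eqP fx.
  by exists x.
have [|a y z /= fy fz|y fy yP] :=
  exists_orthogonal_projection x0 (closed_kernel M0 fM).
- exact: linear0.
- by rewrite linearD linearZ /= fy fz scaler0 addr0.
have fu : f (x0 - y) = f x0 by rewrite linearB /= fy subr0.
set u := x0 - y in fu yP.
have fu0 : f u != 0 by rewrite fu.
have uu0 : hdot u u != 0.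
  by rewrite dnorm_eq0; apply: contra_neq fx0 => u0; rewrite -fu u0 linear0.
exists (((f u / hdot u u)^*)%C *: u) => x.
rewrite linearZr_LR /= conjCK.
have fuxE : f (x - (f x / f u) *: u) = 0.
  by rewrite linearB linearZ /= [X in _ - X](divfK fu0) subrr.
have /eqP : hdot (x - (f x / f u) *: u) u = 0 by rewrite hdotC yP ?rmorph0.
rewrite linearBl /= linearZl_LR /= subr_eq0 => /eqP ->.
by rewrite [RHS]mulrC mulrA (mulrAC _ _ (f u)) divfK// mulfK.
Qed.

(** * Adjoints and existence of projections *)

Section Operators.
Variables (R : realType).
Implicit Types G H K : hilbertType R.

Lemma bop_bounded_ge0 G H (t : bop G H) :
  exists2 M : R[i], 0 <= M & forall x, `|t x| <= M * `|x|.
Proof.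
have [M tM] := bop_bounded t; exists `|M| => // x.
rewrite (le_trans (tM x))// -[X in _ <= _ * X]normr_id -normrM real_ler_norm//.
by rewrite ger0_real// (le_trans _ (tM x)).
Qed.

(** Riesz represents each functional [hdot (t x) y0] of [x]; uniqueness of the representing vector
    makes it linear in [y0]. Hence the default in [adjoint] is never taken. *)
Lemma adjointP G H (t : bop G H) x y : hdot (t x) y = hdot x (adjoint t y).
Proof.
suff [s sP] : exists s : bop H G, forall x y, hdot (t x) y = hdot x (s y).
  have := @xgetPex _ (bop0 H G)
    [set s : bop H G | forall x y, hdot (t x) y = hdot x (s y)].
  by apply; exists s.
have [M M0 tM] := bop_bounded_ge0 t.
have /choice[s sP] y0 : exists z, forall x0, hdot (t x0) y0 = hdot x0 z.
  have fL : linear (fun x => hdot (t x) y0 : R[i]^o).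
    by move=> a x1 x2 /=; rewrite linearP linearDl linearZl_LR.
  pose f : {linear G -> R[i]^o} :=
    HB.pack (fun x => hdot (t x) y0 : R[i]^o)
      (GRing.isLinear.Build _ _ _ _ _ fL).
  apply: (@Riesz_representation _ _ f (M * `|y0|)) => [|x1].
    by rewrite mulr_ge0.
  by rewrite (le_trans (hdot_CauchySchwarz _ _))// mulrAC ler_wpM2r.
have sL : linear s.
  move=> a y1 y2; apply: hdot_injr => z.
  by rewrite -sP !linearDr/= !linearZr_LR/= !sP.
pose sl : {linear H -> G} := HB.pack s (GRing.isLinear.Build _ _ _ _ _ sL).
(* The bound of [t] serves again: estimate [hdot (t (s z)) z] by Cauchy-Schwarz and cancel one
   factor, the norm of [s z]. *)
have sB : exists N : R[i], forall y, `|sl y| <= N * `|y|.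
  exists M => z /=; have [->|sz] := eqVneq (s z) 0.
    by rewrite normr0 mulr_ge0.
  rewrite -(@ler_pM2r _ `|s z|) ?normr_gt0// -expr2 norm_hdot -sP.
  rewrite -[leLHS]ger0_norm ?sP ?dnorm_ge0// -sP.
  by rewrite (le_trans (hdot_CauchySchwarz _ _))// mulrAC ler_wpM2r.
by exists (Bop sB).
Qed.

Lemma adjointPr G H (t : bop G H) x y : hdot (adjoint t x) y = hdot x (t y).
Proof. by rewrite hdotC -adjointP -hdotC. Qed.

Lemma exists_projection H (C : set H) :
  closed C -> C 0 -> (forall a y z, C y -> C z -> C (y + a *: z)) ->
  exists2 p : bop H H, projection p &
    (forall x, C (p x)) /\ (forall x, C x -> p x = x).
Proof.
move=> clC C0 CD.
have /choice[p pP] x : exists y, C y /\ forall z, C z -> hdot (x - y) z = 0.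
  by have [y] := exists_orthogonal_projection x clC C0 CD; exists y.
have Cp x : C (p x) by case: (pP x).
(* Two candidates differ by a vector both in [C] and orthogonal to [C]. This uniqueness yields
   linearity and that [p] fixes [C]. *)
have pE x y : C y -> (forall z, C z -> hdot (x - y) z = 0) -> p x = y.
  move=> Cy xy; apply/eqP; rewrite -subr_eq0; apply/eqP/hdot_eq0.
  have Cz : C (p x - y) by rewrite -(scaleN1r y); exact: CD.
  have {1}-> : p x - y = x - y - (x - p x).
    by rewrite opprB [RHS]addrC addrA subrK.
  by rewrite linearBl/= xy// (pP x).2// subrr.
have pL : linear p.
  move=> a x y; apply: pE => [|z Cz]; first by rewrite addrC; exact: CD.
  rewrite opprD addrACA -scalerBr linearDl linearZl_LR /=.
  by rewrite !(pP _).2// mulr0 addr0.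
pose pl : {linear H -> H} := HB.pack p (GRing.isLinear.Build _ _ _ _ _ pL).
have pp x y : hdot (p x) (p y) = hdot (p x) y.
  apply/eqP; rewrite eq_sym -subr_eq0 -linearBr/= hdotC (pP y).2//.
  by rewrite rmorph0.
have pB : exists N : R[i], forall x, `|pl x| <= N * `|x|.
  exists 1 => x /=; rewrite mul1r; have [->|px] := eqVneq (p x) 0.
    by rewrite normr0.
  rewrite -(@ler_pM2r _ `|p x|) ?normr_gt0// -expr2 norm_hdot.
  rewrite -[leLHS]ger0_norm ?dnorm_ge0// pp mulrC.
  exact: hdot_CauchySchwarz.
exists (Bop pB).
  apply: bopP => x; apply: hdot_injr => y /=.
  by rewrite -adjointP [RHS]hdotC -pp -hdotC.
split=> // x Cx /=; apply: pE => // z _.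
by rewrite subrr linear0l.
Qed.

(** * Geometry and order of projections *)

Section Projection.
Variables (H : hilbertType R) (p : bop H H).
Hypothesis pP : projection p.

(** The left side is Hermitian in [x] and [y], so this one identity gives both self-adjointness and
    idempotence. *)
Lemma projection_hdot x y : hdot (p x) (p y) = hdot (p x) y.
Proof. by rewrite -{3}pP /= -adjointPr adjointP. Qed.

Lemma projection_hdotC x y : hdot (p x) y = hdot x (p y).
Proof. by rewrite -projection_hdot hdotC projection_hdot -hdotC. Qed.

Lemma projection_idem x : p (p x) = p x.
Proof.
apply: hdot_injr => y.
by rewrite -projection_hdotC projection_hdot projection_hdotC.
Qed.

Lemma projection_normB x : `|x - p x| ^+ 2 = `|x| ^+ 2 - `|p x| ^+ 2.
Proof.
by rewrite !norm_hdot linearBl/= !linearBr/= projection_hdot subrr subr0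
  projection_hdotC.
Qed.

Lemma projection_norm_le x : `|p x| <= `|x|.
Proof.
by rewrite -(@ler_pXn2r _ 2)// ?nnegrE// -subr_ge0 -projection_normB exprn_ge0.
Qed.

Lemma projection_normE x : `|p x| = `|x| -> p x = x.
Proof.
move=> e; apply/esym/eqP; rewrite -subr_eq0 -normr_eq0 -sqrf_eq0.
by rewrite projection_normB e subrr.
Qed.

End Projection.

(** Taking adjoints turns [q p = p] into [p = p q], so [hdot (p x) x] is the squared norm of
    [p (q x)], at most that of [q x]. *)
Lemma projection_le H (p q : bop H H) :
  projection p -> projection q -> (forall x, q (p x) = p x) -> op_le p q.
Proof.
move=> pP qP qp x /=.
have pq : p x = p (q x).
  by apply: hdot_injr => y; rewrite -!projection_hdotC// qp.
rewrite linearBl/= subr_ge0 -(projection_hdot qP) -(projection_hdot pP).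
rewrite -!norm_hdot {1}pq.
by rewrite ler_pXn2r ?nnegrE// projection_norm_le.
Qed.

(** Testing the order at [p x] shows that [q] does not shrink this vector, so it fixes it. *)
Lemma le_projectionP H (p q : bop H H) :
  projection p -> projection q -> op_le p q -> forall x, q (p x) = p x.
Proof.
move=> pP qP pq x; apply: projection_normE => //; apply/le_anti.
rewrite projection_norm_le//= -(@ler_pXn2r _ 2)// ?nnegrE// !norm_hdot.
have := pq (p x).
by rewrite /= linearBl/= subr_ge0 projection_idem// (projection_hdot qP).
Qed.

Lemma projection_le_anti H (p q : bop H H) :
  projection p -> projection q -> op_le p q -> op_le q p -> p = q.
Proof.
move=> pP qP pq qp; apply: bopP => x; apply: hdot_injr => y.
rewrite -(le_projectionP qP pP qp x) -!projection_hdotC//.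
by rewrite le_projectionP.
Qed.

Lemma projection_intro H (p : bop H H) :
  (forall x y, hdot (p x) (p y) = hdot x (p y)) -> projection p.
Proof.
by move=> pE; apply: bopP => x; apply: hdot_injr => y /=; rewrite -adjointP.
Qed.

(** * Partial isometries *)

Section PartialIsometry.
Variables (G H : hilbertType R) (w : bop G H).
Hypothesis wP : partial_isometry w.

Lemma partial_isometryE x : w (adjoint w (w x)) = w x.
Proof. by rewrite -{4}wP. Qed.

Lemma partial_isometry_initial : projection (bop_comp (adjoint w) w).
Proof.
apply: projection_intro => x y /=.
by rewrite adjointPr partial_isometryE adjointP.
Qed.

Lemma partial_isometry_final : projection (bop_comp w (adjoint w)).
Proof.
apply: projection_intro => x y /=.
by rewrite -[LHS]adjointPr -[LHS]adjointP partial_isometryE adjointP adjointPr.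
Qed.

(** Transfers contractivity and its equality case from the projection [w^* w] to [w]. *)
Lemma partial_isometry_norm x : `|w x| = `|adjoint w (w x)|.
Proof.
by apply/eqP; rewrite -(@eqrXn2 _ 2)// !norm_hdot adjointPr partial_isometryE.
Qed.

Lemma partial_isometry_norm_le x : `|w x| <= `|x|.
Proof.
rewrite partial_isometry_norm.
exact: (projection_norm_le partial_isometry_initial x).
Qed.

Lemma partial_isometry_normE x : `|w x| = `|x| -> adjoint w (w x) = x.
Proof.
rewrite partial_isometry_norm.
by move=> /(@projection_normE _ _ partial_isometry_initial x).
Qed.

End PartialIsometry.

Lemma closed_equalizer G H (s t : bop G H) : closed [set x | s x = t x].
Proof.
have [M M0 stM] := bop_bounded_ge0 (bop_sub s t).
rewrite (_ : mkset _ = [set x | bop_sub s t x = 0]).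
  exact: closed_kernel M0 stM.
by apply/seteqP; split=> x /= st; apply/eqP; move/eqP: st; rewrite subr_eq0.
Qed.

Lemma closed_fixpoints H (t : bop H H) : closed [set x | t x = x].
Proof.
have idB : exists M : R[i],
    forall x : H, `|(idfun : {linear H -> H}) x| <= M * `|x|.
  by exists 1 => x; rewrite mul1r.
exact: (@closed_equalizer _ _ t (Bop idB)).
Qed.

End Operators.

(** * The maximal projection *)

Local Open Scope bop_scope.

Theorem theorem2p6 (R : realType) (G H K : hilbertType R)
    (w : bop G H) (v : bop H K) :
  partial_isometry w -> partial_isometry v ->
  exists p : bop G G,
    unique (maximal_op (fun q : bop G G =>
              projection q /\ (v * w * q)^* * (v * w * q) = q)) p /\
    p <= w^* * w /\
    partial_isometry (w * p) /\
    (w * p) * (w * p)^* <= v^* * v.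
Proof.
move=> wP vP.
pose C := [set x | adjoint w (w x) = x] `&` [set x | adjoint v (v (w x)) = w x].
have clC : closed C.
  apply: closedI; first exact: (@closed_fixpoints _ _ (w^* * w)).
  exact: (@closed_equalizer _ _ _ (v^* * v * w) w).
have C0 : C 0 by split; rewrite /= !linear0.
have CD a y z : C y -> C z -> C (y + a *: z)%R.
  by move=> [/= wy vy] [/= wz vz]; split;
    rewrite /= !linearD !linearZ /= ?wy ?wz ?vy ?vz.
have [p pP [Cp pC]] := exists_projection clC C0 CD.
have wp x : adjoint w (w (p x)) = p x by case: (Cp x).
have vp x : adjoint v (v (w (p x))) = w (p x) by case: (Cp x).
(* Since [p] is self-adjoint, [(w p)^* w p = p w^* w p = p p = p]. *)
have wpE x : adjoint (w * p) (w (p x)) = p x.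
  apply: hdot_injr => y; rewrite -adjointP /= adjointP wp.
  by rewrite projection_hdot// projection_hdotC.
have wpP : partial_isometry (w * p).
  by apply: bopP => x /=; rewrite wpE projection_idem.
set S := (X in maximal_op X).
have Sp : S p.
  split=> //; apply: bopP => x; apply: hdot_injr => y /=.
  rewrite -adjointP /= adjointP vp adjointP wp.
  by rewrite projection_hdot// projection_hdotC.
have Sle q : S q -> q <= p.
  move=> [qP qE]; apply: projection_le => // x; apply: pC.
  have vwq : `|v (w (q x))|%R = `|q x|%R.
    apply/eqP; rewrite -(@eqrXn2 _ 2)// !norm_hdot; apply/eqP.
    rewrite -[LHS]/(hdot ((v * w * q) x) ((v * w * q) x)) adjointP.
    rewrite -[adjoint _ _]/(((v * w * q)^* * (v * w * q)) x) qE.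
    by rewrite projection_hdot// projection_hdotC.
  have wq : `|w (q x)|%R = `|q x|%R.
    apply/le_anti; rewrite partial_isometry_norm_le//= -vwq.
    exact: partial_isometry_norm_le.
  by split; apply: partial_isometry_normE => //; rewrite vwq.
exists p; split; last split; last split=> //.
(* As [p] is the greatest element of [S], any maximal [q] lies below [p] and so equals it. *)
- split=> [|q [Sq qmax]]; last by apply: qmax => //; exact: Sle.
  split=> // q Sq pq; apply: projection_le_anti => //; last exact: Sle.
  by case: Sq.
- by apply: projection_le => //; exact: partial_isometry_initial.
(* The values of [(w p) (w p)^*] have the form [w (p z)], which [v^* v] fixes. *)
- apply: projection_le => [||x]; last exact: vp.
  + exact: partial_isometry_final.
  + exact: partial_isometry_initial.
Qed.
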